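(* Let $t$ be a closed term. If $\Phi$ is a derivation in the CbNeed type system of $\vdash^{(m,e)} t : M$ (empty type context), then there is a term $s$ and an evaluation sequence $d \colon t \to_{\mathrm{need}}^{*} s$ such that $\mathrm{normal}(s)$, $|d|_{m} \leq m$ and $|d|_{e} \leq e$. Moreover, if $\Phi$ is tight then $|d|_{m} = m$ and $|d|_{e} = e$.
   Context: Terms: $t,s ::= x \mid \lambda x.t \mid t\,s \mid t[x\leftarrow s]$, where $t[x\leftarrow s]$ (explicit substitution) binds $x$ in $t$; values $v ::= \lambda x.t$. $\mathrm{fv}(t[x\leftarrow s])=(\mathrm{fv}(t)\setminus\{x\})\cup\mathrm{fv}(s)$; $t$ is closed if $\mathrm{fv}(t)=\emptyset$; terms are up to $\alpha$-equivalence. Contexts (one hole $\langle\cdot\rangle$): substitution contexts $S ::= \langle\cdot\rangle \mid S[x\leftarrow t]$; CbNeed contexts $E ::= \langle\cdot\rangle \mid E\,t \mid E[x\leftarrow t] \mid E\langle\langle x\rangle\rangle[x\leftarrow E']$. $E\langle t\rangle$ is plugging (may capture); $E\langle\langle t\rangle\rangle$ denotes plugging where $E$ does not capture free variables of $t$. Root steps: $S\langle\lambda x.t\rangle s \mapsto_m S\langle t[x\leftarrow s]\rangle$ (variables bound by $S$ disjoint from $\mathrm{fv}(s)$); $E\langle\langle x\rangle\rangle[x\leftarrow S\langle v\rangle] \mapsto_{e} S\langle E\langle\langle v\rangle\rangle[x\leftarrow v]\rangle$ (variables bound by $S$ disjoint from $\mathrm{fv}(E\langle\langle x\rangle\rangle)$).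 $\to_{m,\mathrm{need}}$ (resp. $\to_{e,\mathrm{need}}$) relates $E\langle t'\rangle$ to $E\langle s'\rangle$ for any CbNeed context $E$ whenever $t'\mapsto_m s'$ (resp. $t'\mapsto_e s'$); $\to_{\mathrm{need}}=\to_{m,\mathrm{need}}\cup\to_{e,\mathrm{need}}$. For an evaluation sequence $d$, $|d|_m$, $|d|_e$ are its numbers of multiplicative and exponential steps. $\mathrm{normal}$ is the least predicate with $\mathrm{normal}(\lambda x.t)$ and $\mathrm{normal}(t)\Rightarrow\mathrm{normal}(t[x\leftarrow s])$. CbNeed types: linear types $L ::= \mathsf{normal} \mid M \to N$; multi types $M,N ::= [L_i]_{i\in J}$ finite multisets ($J$ finite), $\mathbf{0}$ the empty multiset, $\uplus$ multiset union. A type context $\Gamma$ maps variables to multi types, all but finitely many to $\mathbf 0$; $\mathrm{dom}(\Gamma)=\{x\mid\Gamma(x)\neq\mathbf 0\}$; $\Gamma$ is empty if its domain is empty; $\uplus$ extends pointwise; $\Gamma, x:M$ means $\Gamma\uplus(x\mapsto M)$ with $x\notin\mathrm{dom}(\Gamma)$. Judgements $\Gamma\vdash^{(m,e)} t : T$, $m,e\in\mathbb N$. Rules: (ax) $x:M \vdash^{(0,1)} x : M$ (with $M\neq\mathbf 0$, axioms not introducing $\mathbf 0$); (normal) $\vdash^{(0,0)} \lambda x.t : \mathsf{normal}$; (fun) from $\Gamma, x:M \vdash^{(m,e)} t : N$ infer $\Gamma\vdash^{(m,e)} \lambda x.t : M\to N$; (many) from $\Gamma_i\vdash^{(m_i,e_i)}\lambda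 x.t : L_i$ for $i\in J$, $J\neq\emptyset$, infer $\biguplus_i\Gamma_i\vdash^{(\sum m_i,\sum e_i)}\lambda x.t : [L_i]_{i\in J}$; (app$_{gc}$) from $\Gamma\vdash^{(m,e)} t:[\mathbf 0\to M]$ infer $\Gamma\vdash^{(m+1,e)} t\,s : M$; (app) from $\Gamma\vdash^{(m,e)} t : [N\to M]$ and $\Pi\vdash^{(m',e')} s:N$ with $N\neq\mathbf 0$ infer $\Gamma\uplus\Pi\vdash^{(m+m'+1,e+e')} t\,s:M$; (ES$_{gc}$) from $\Gamma\vdash^{(m,e)} t:M$ with $\Gamma(x)=\mathbf 0$ infer $\Gamma\vdash^{(m,e)} t[x\leftarrow s]:M$; (ES) from $\Gamma,x:N\vdash^{(m,e)} t:M$ and $\Pi\vdash^{(m',e')} s:N$ with $N\neq\mathbf 0$ infer $\Gamma\uplus\Pi\vdash^{(m+m',e+e')} t[x\leftarrow s]:M$. A derivation of $\Gamma\vdash^{(m,e)} t:M$ is tight if $M=[\mathsf{normal}]$ and $\Gamma$ is empty. *)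

(* Defs.v *)
(* MathComp world, with finmap for finite multisets and finitely supported
   functions. *)
From Stdlib Require List.
From HB Require Import structures.
From mathcomp Require Import all_boot.
From mathcomp Require Import finmap multiset.

Set Implicit Arguments.
Unset Strict Implicit.
Unset Printing Implicit Defensive.

Local Open Scope mset_scope.
Local Open Scope fset_scope.
Local Open Scope nat_scope.

(** * Terms and call-by-need evaluation *)

(* Terms up to alpha-equivalence, as de Bruijn terms.  [Subst t s] is the
   explicit substitution t[x<-s]: it binds index 0 in [t], nothing in [s]. *)
Inductive term : Type :=
| Var of nat
| Lam of term
| App of term & term
| Subst of term & term.

(* [fv t i]: the variable of index [i], counted from the root of [t], is free
   in [t]. *)
Fixpoint fv (t : term) : pred nat :=
  match t with
  | Var j => pred1 j
  | Lam u => [pred i | fv u i.+1]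
  | App u s => predU (fv u) (fv s)
  | Subst u s => [pred i | fv u i.+1 || fv s i]
  end.

Definition closed_term (t : term) : Prop := fv t =i pred0.

(* Renaming of the indices [>= c] by adding [k]: the transport of a term under
   [k] additional binders (inserted above the innermost [c] ones). *)
Fixpoint tlift (k c : nat) (t : term) : term :=
  match t with
  | Var j => Var (if c <= j then k + j else j)
  | Lam u => Lam (tlift k c.+1 u)
  | App u s => App (tlift k c u) (tlift k c s)
  | Subst u s => Subst (tlift k c.+1 u) (tlift k c s)
  end.

Inductive sctx : Type :=
| SHole
| SSub of sctx & term.

Fixpoint splug (S : sctx) (t : term) : term :=
  match S with
  | SHole => t
  | SSub S' s => Subst (splug S' t) s
  end.

(* Number of binders between the root and the hole. *)
Fixpoint sbinders (S : sctx) : nat :=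
  match S with
  | SHole => 0
  | SSub S' _ => (sbinders S').+1
  end.

(* [ENeed E E'] is E<<x>>[x<-E'], with x the index 0 at the root of [E]. *)
Inductive ectx : Type :=
| EHole
| EApp of ectx & term
| ESub of ectx & term
| ENeed of ectx & ectx.

Fixpoint ebinders (E : ectx) : nat :=
  match E with
  | EHole => 0
  | EApp E' _ => ebinders E'
  | ESub E' _ => (ebinders E').+1
  | ENeed _ E' => ebinders E'
  end.

(* Plugging E<t>, which may capture: [t] lives in the scope of the hole.  In the
   last case the hole of [E1] receives the variable of index 0 at the root of
   [E1], i.e. of index [ebinders E1] at the hole. *)
Fixpoint plug (E : ectx) (t : term) : term :=
  match E with
  | EHole => t
  | EApp E' s => App (plug E' t) s
  | ESub E' s => Subst (plug E' t) s
  | ENeed E1 E2 => Subst (plug E1 (Var (ebinders E1))) (plug E2 t)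
  end.

(* Plugging E<<t>> without capture: [t] lives in the scope of the root. *)
Definition plug_nc (E : ectx) (t : term) : term :=
  plug E (tlift (ebinders E) 0 t).

Lemma plug_ENeed (E1 E2 : ectx) (t : term) :
  plug (ENeed E1 E2) t = Subst (plug_nc E1 (Var 0)) (plug E2 t).
Proof. by rewrite /plug_nc /= addn0. Qed.

Fixpoint elift (k c : nat) (E : ectx) : ectx :=
  match E with
  | EHole => EHole
  | EApp E' s => EApp (elift k c E') (tlift k c s)
  | ESub E' s => ESub (elift k c.+1 E') (tlift k c s)
  | ENeed E1 E2 => ENeed (elift k c.+1 E1) (elift k c E2)
  end.

Lemma ebinders_elift (k c : nat) (E : ectx) :
  ebinders (elift k c E) = ebinders E.
Proof.
by elim: E c => [|E IH s|E IH s|E1 _ E2 IH] c //=; rewrite IH.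
Qed.

Lemma tlift_plug (k c : nat) (E : ectx) (t : term) :
  tlift k c (plug E t) = plug (elift k c E) (tlift k (ebinders E + c) t).
Proof.
elim: E c t => [|E IH s|E IH s|E1 IH1 E2 IH2] c t //=; rewrite ?IH ?addnS //.
by rewrite IH1 IH2 /= ebinders_elift addnS ltnNge leq_addr.
Qed.

(* The side conditions on bound variables of the root steps are always met up
   to alpha-renaming; here they become the liftings of what enters the scope of
   [S] (and of x, for the copy of the value). *)
Inductive root_m : term -> term -> Prop :=
| RootM (S : sctx) (t s : term) :
    root_m (App (splug S (Lam t)) s)
           (splug S (Subst t (tlift (sbinders S) 0 s))).

Inductive root_e : term -> term -> Prop :=
| RootE (E : ectx) (S : sctx) (u : term) :
    root_e (Subst (plug_nc E (Var 0)) (splug S (Lam u)))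
           (splug S
              (Subst (plug_nc (elift (sbinders S) 1 E) (tlift 1 0 (Lam u)))
                     (Lam u))).

Inductive step_m : term -> term -> Prop :=
| StepM (E : ectx) (t s : term) : root_m t s -> step_m (plug E t) (plug E s).

Inductive step_e : term -> term -> Prop :=
| StepE (E : ectx) (t s : term) : root_e t s -> step_e (plug E t) (plug E s).

Inductive evseq : term -> term -> Type :=
| EvNil (t : term) : evseq t t
| EvM (t u s : term) : step_m t u -> evseq u s -> evseq t s
| EvE (t u s : term) : step_e t u -> evseq u s -> evseq t s.

Fixpoint size_m (t s : term) (d : evseq t s) : nat :=
  match d with
  | EvNil _ => 0
  | EvM _ _ _ _ d' => (size_m d').+1
  | EvE _ _ _ _ d' => size_m d'
  end.

Fixpoint size_e (t s : term) (d : evseq t s) : nat :=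
  match d with
  | EvNil _ => 0
  | EvM _ _ _ _ d' => size_e d'
  | EvE _ _ _ _ d' => (size_e d').+1
  end.

Inductive normal : term -> Prop :=
| NormalLam (t : term) : normal (Lam t)
| NormalSubst (t s : term) : normal t -> normal (Subst t s).

(** * Linear types and multi types *)

(* The type [lty] of linear types is the least solution of
     L ::= normal | {mset L} -> {mset L}.
   It is built from trees [rty] with lists in place of multisets, by selecting
   the trees all of whose lists are sorted for some fixed total order: each
   multiset has exactly one sorted listing.  Only [lnormal], [larr] and the
   facts [larr_inj], [larr_neq_lnormal], [lty_ind] (the constructors, their
   injectivity and disjointness, and induction) are meant to be used. *)
Inductive rty : Type :=
| RNormal
| RArr of seq rty & seq rty.

Fixpoint rty_encode (r : rty) : GenTree.tree unit :=
  match r with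
  | RNormal => GenTree.Leaf tt
  | RArr s t =>
      GenTree.Node (size s) (map rty_encode s ++ map rty_encode t)
  end.

Fixpoint rty_decode (g : GenTree.tree unit) : rty :=
  match g with
  | GenTree.Leaf _ => RNormal
  | GenTree.Node n l =>
      RArr (take n (map rty_decode l)) (drop n (map rty_decode l))
  end.

Fixpoint rty_ind' (P : rty -> Prop) (Pn : P RNormal)
    (Pa : forall s t, (forall r, List.In r s -> P r) ->
                      (forall r, List.In r t -> P r) -> P (RArr s t))
    (r : rty) {struct r} : P r :=
  let fix all_in (s : seq rty) : forall r, List.In r s -> P r :=
    match s return forall r, List.In r s -> P r with
    | [::] => fun r (h : False) => match h with end
    | x :: s' => fun r (h : x = r \/ List.In r s') =>
        match h with
        | or_introl e => match e in _ = y return P y with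
                         | erefl => rty_ind' Pn Pa x
                         end
        | or_intror h' => all_in s' r h'
        end
    end in
  match r with
  | RNormal => Pn
  | RArr s t => Pa s t (all_in s) (all_in t)
  end.

Lemma rty_encodeK : cancel rty_encode rty_decode.
Proof.
have mapK s : (forall r, List.In r s -> rty_decode (rty_encode r) = r) ->
    map rty_decode (map rty_encode s) = s.
  elim: s => //= x s IH h; rewrite h; last by left.
  by rewrite IH // => r hr; apply: h; right.
elim/rty_ind' => //= s t /mapK hs /mapK ht.
by rewrite map_cat hs ht take_size_cat // drop_size_cat.
Qed.

HB.instance Definition _ := Countable.copy rty (can_type rty_encodeK).

Definition rle (x y : rty) : bool := choice.pickle x <= choice.pickle y.

Lemma rle_total : total rle. Proof. by move=> x y; exact: leq_total. Qed.

Lemma rle_trans : transitive rle. Proof. by move=> y x z; exact: leq_trans. Qed.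

Lemma rle_anti : antisymmetric rle.
Proof.
by move=> x y; rewrite -eqn_leq => /eqP /(pcan_inj (@choice.pickleK rty)).
Qed.

Fixpoint rcanonical (r : rty) : bool :=
  match r with
  | RNormal => true
  | RArr s t => [&& sorted rle s, sorted rle t,
                    all rcanonical s & all rcanonical t]
  end.

Record lty : Type := LTy { rty_of : rty; rty_ofP : rcanonical rty_of }.

HB.instance Definition _ := [isSub for rty_of].
HB.instance Definition _ := [Countable of lty by <:].

Notation multi := {mset lty}.

Definition lnormal : lty := @LTy RNormal isT.

Definition listing (M : multi) : seq rty :=
  sort rle (map rty_of (enum_mset M)).

Lemma all_rcanonical (s : seq lty) : all rcanonical (map rty_of s).
Proof. by apply/allP => _ /mapP[L _ ->]; exact: rty_ofP. Qed.

Lemma larr_subproof (M N : multi) : rcanonical (RArr (listing M) (listing N)).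
Proof.
by rewrite /= !sort_sorted ?all_sort ?all_rcanonical //; exact: rle_total.
Qed.

Definition larr (M N : multi) : lty := LTy (larr_subproof M N).

Lemma listing_inj : injective listing.
Proof.
move=> M N /(perm_sortP rle_total rle_trans rle_anti).
move=> /(perm_map_inj val_inj) h; rewrite -(seq_mset_id M) -(seq_mset_id N).
exact/eq_seq_msetP.
Qed.

Lemma larr_inj (M N M' N' : multi) :
  larr M N = larr M' N' -> M = M' /\ N = N'.
Proof. by case=> /listing_inj-> /listing_inj->. Qed.

Lemma larr_neq_lnormal (M N : multi) : larr M N <> lnormal.
Proof. by []. Qed.

Lemma listing_surj (s : seq rty) :
  sorted rle s -> all rcanonical s -> exists M : multi, listing M = s.
Proof.
move=> srt can.
have [l def_s] : exists l : seq lty, map rty_of l = s.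
  elim: s can {srt} => [|r s IH] /=; first by exists [::].
  by case/andP=> hr /IH[l <-]; exists (LTy hr :: l).
exists (seq_mset l).
apply: (sorted_eq rle_trans rle_anti) => //.
  exact: sort_sorted rle_total _.
by rewrite perm_sort -def_s perm_map // perm_eq_seq_mset.
Qed.

Lemma lty_ind (P : lty -> Prop) :
  P lnormal ->
  (forall M N : multi, {in M, forall L, P L} -> {in N, forall L, P L} ->
     P (larr M N)) ->
  forall L, P L.
Proof.
move=> Pn Pa [r hr]; elim/rty_ind': r hr => [|s t IHs IHt] hr.
  by rewrite (_ : LTy hr = lnormal) //; exact: val_inj.
have IH (u : seq rty) (M : multi) : listing M = u ->
    (forall r, List.In r u -> forall h : rcanonical r, P (LTy h)) ->
    {in M, forall L, P L}.
  move=> def_u IHu L LM; have : rty_of L \in u.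
    by rewrite -def_u mem_sort map_f.
  move=> Lu; have {}Lu : List.In (rty_of L) u.
    elim: u Lu {def_u IHu} => //= x u IH; rewrite inE => /predU1P[->|/IH] //.
      by left.
    by right.
  by case: L {LM} Lu => r h /IHu; exact.
case/and4P: (hr) => srts srtt cans cant.
have [M defM] := listing_surj srts cans.
have [N defN] := listing_surj srtt cant.
rewrite (_ : LTy hr = larr M N); last by apply: val_inj; rewrite /= defM defN.
by apply: Pa; [exact: IH defM IHs | exact: IH defN IHt].
Qed.

(** * Type contexts *)

Definition ctx : Type := {fsfun nat -> multi with mset0 : multi}.

Definition ctx0 : ctx := [fsfun].

Definition ctx1 (x : nat) (M : multi) : ctx := [fsfun i in [fset x] => M].

Definition ctxD (G H : ctx) : ctx :=
  [fsfun i in finsupp G `|` finsupp H => G i `+` H i].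

(* The context G, x:M with x the variable of index 0; the variables of [G] are
   shifted by one, so that x is automatically outside the domain of [G]. *)
Definition ctx_cons (M : multi) (G : ctx) : ctx :=
  [fsfun i in 0 |` [fset j.+1 | j in finsupp G] =>
     if i is j.+1 then G j else M].

Lemma ctxP (G H : ctx) : G =1 H <-> G = H.
Proof. exact: fsfunP. Qed.

Lemma ctx0E (i : nat) : ctx0 i = mset0.
Proof. by rewrite fsfunE. Qed.

Lemma ctx1E (x : nat) (M : multi) (i : nat) :
  ctx1 x M i = if i == x then M else mset0.
Proof. by rewrite fsfunE inE. Qed.

Lemma ctxDE (G H : ctx) (i : nat) : ctxD G H i = G i `+` H i.
Proof.
rewrite fsfunE in_fsetU; case: finsuppP => // _; case: finsuppP => //= _.
by rewrite mset0D.
Qed.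

Lemma ctx_cons0 (M : multi) (G : ctx) : ctx_cons M G 0 = M.
Proof. by rewrite fsfunE !inE eqxx. Qed.

Lemma ctx_consS (M : multi) (G : ctx) (i : nat) : ctx_cons M G i.+1 = G i.
Proof.
rewrite fsfunE !inE /=; case: ifP => // /negbT.
by rewrite mem_imfset /=; [case: finsuppP | exact: succn_inj].
Qed.

Lemma ctxDA : associative ctxD.
Proof. by move=> A B C; apply/ctxP => i; rewrite !ctxDE msetDA. Qed.

Lemma ctxDC : commutative ctxD.
Proof. by move=> A B; apply/ctxP => i; rewrite !ctxDE msetDC. Qed.

Lemma ctx0D : left_id ctx0 ctxD.
Proof. by move=> A; apply/ctxP => i; rewrite ctxDE ctx0E mset0D. Qed.

HB.instance Definition _ := Monoid.isComLaw.Build ctx ctx0 ctxD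
  ctxDA ctxDC ctx0D.

(** * Typing derivations *)

Inductive ty : Type :=
| TLin of lty
| TMulti of multi.

(* [deriv m e G t T] is the judgement G |-^(m,e) t : T.  In [DMany] the finite
   nonempty index set J is 'I_n with 0 < n. *)
Inductive deriv : nat -> nat -> ctx -> term -> ty -> Prop :=
| DAx (x : nat) (M : multi) :
    M <> mset0 ->
    deriv 0 1 (ctx1 x M) (Var x) (TMulti M)
| DNormal (t : term) :
    deriv 0 0 ctx0 (Lam t) (TLin lnormal)
| DFun (m e : nat) (G : ctx) (t : term) (M N : multi) :
    deriv m e (ctx_cons M G) t (TMulti N) ->
    deriv m e G (Lam t) (TLin (larr M N))
| DMany (n : nat) (m e : 'I_n -> nat) (G : 'I_n -> ctx) (t : term)
    (L : 'I_n -> lty) :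
    0 < n ->
    (forall i, deriv (m i) (e i) (G i) (Lam t) (TLin (L i))) ->
    deriv (\sum_(i < n) m i) (\sum_(i < n) e i) (\big[ctxD/ctx0]_(i < n) G i)
      (Lam t) (TMulti (seq_mset [seq L i | i : 'I_n]))
| DAppGc (m e : nat) (G : ctx) (t s : term) (M : multi) :
    deriv m e G t (TMulti [mset larr mset0 M]) ->
    deriv m.+1 e G (App t s) (TMulti M)
| DApp (m e m' e' : nat) (G P : ctx) (t s : term) (N M : multi) :
    N <> mset0 ->
    deriv m e G t (TMulti [mset larr N M]) ->
    deriv m' e' P s (TMulti N) ->
    deriv (m + m' + 1) (e + e') (ctxD G P) (App t s) (TMulti M)
| DSubGc (m e : nat) (G : ctx) (t s : term) (M : multi) :
    deriv m e (ctx_cons mset0 G) t (TMulti M) ->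
    deriv m e G (Subst t s) (TMulti M)
| DSub (m e m' e' : nat) (G P : ctx) (t s : term) (N M : multi) :
    N <> mset0 ->
    deriv m e (ctx_cons N G) t (TMulti M) ->
    deriv m' e' P s (TMulti N) ->
    deriv (m + m') (e + e') (ctxD G P) (Subst t s) (TMulti M).

(* A property of derivations that depends on their final judgement only. *)
Definition tight (m e : nat) (G : ctx) (t : term) (T : ty)
    (Phi : deriv m e G t T) : Prop :=
  T = TMulti [mset lnormal] /\ G = ctx0.

(* Main.v *)
(* Subject reduction is exact on the counters.  Every rule types the hole of a
   CbNeed context exactly once, so a multiplicative step erases exactly one
   application rule, and an exponential step replaces exactly one axiom by a part
   of the derivation of the value, which splits along the multiset sum.  Hence
   m + e decreases, and evaluation stops after at most m multiplicative and e
   exponential steps.  Any term is normal, steps, or is E<<x>> for some free x;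
   a typing of E<<x>> assigns x a nonempty multi type, which excludes the last
   case in the empty context.  A normal term of type [normal] has counters (0,0),
   so tight derivations measure the evaluation exactly. *)
Require Import Defs.
From mathcomp Require Import all_boot.
From mathcomp Require Import finmap multiset zify.

Set Implicit Arguments.
Unset Strict Implicit.
Unset Printing Implicit Defensive.

Local Open Scope mset_scope.
Local Open Scope fset_scope.
Local Open Scope nat_scope.

(** * Type contexts *)

Lemma ctxD0 (G : ctx) : ctxD G ctx0 = G.
Proof. by rewrite ctxDC ctx0D. Qed.

Lemma ctx_cons00 : ctx_cons mset0 ctx0 = ctx0.
Proof. by apply/ctxP => -[|i]; rewrite ?ctx_cons0 ?ctx_consS !ctx0E. Qed.

Lemma ctx_consD (M N : multi) (G H : ctx) :
  ctxD (ctx_cons M G) (ctx_cons N H) = ctx_cons (M `+` N) (ctxD G H).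
Proof.
by apply/ctxP => -[|i]; rewrite ctxDE ?ctx_cons0 ?ctx_consS ?ctxDE.
Qed.

Lemma ctx_cons_inj (M N : multi) (G H : ctx) :
  ctx_cons M G = ctx_cons N H -> M = N /\ G = H.
Proof.
move=> /ctxP eqG; split; first by have := eqG 0; rewrite !ctx_cons0.
by apply/ctxP => i; have := eqG i.+1; rewrite !ctx_consS.
Qed.

Lemma ctx_consP (G : ctx) : exists H, G = ctx_cons (G 0) H.
Proof.
(* Tail of [G]: every nonzero index of its support moves down by one. The junk index [0.-1 = 0] in
   the support is harmless, since the values are read off [G] itself. *)
exists [fsfun i in [fset i.-1 | i in finsupp G] => G i.+1].
apply/ctxP => -[|i]; rewrite ?ctx_cons0 // ctx_consS fsfunE.
case: ifP => // /negP nGi; case: finsuppP => // Gi; case: nGi.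
by apply/imfsetP; exists i.+1.
Qed.

Lemma ctxDI (P : ctx) : injective (ctxD^~ P).
Proof.
move=> G H /ctxP eqD; apply/ctxP => i; apply/msetP => L.
by have /msetP/(_ L) := eqD i; rewrite !ctxDE !msetE2; lia.
Qed.

(** * Type contexts under inserted binders *)

Definition ren (k c i : nat) : nat := if c <= i then k + i else i.

Lemma ren_inj (k c : nat) : injective (ren k c).
Proof. by rewrite /ren => i j; do 2!case: ifP; lia. Qed.

(** The type context that accompanies [tlift k c]: types follow their renamed variables, and the
    inserted indices, being outside the support, get [mset0]. *)
Definition clift (k c : nat) (G : ctx) : ctx :=
  [fsfun i in [fset ren k c j | j in finsupp G] =>
     if i < c then G i else G (i - k)].

Lemma clift_ren (k c : nat) (G : ctx) (i : nat) :
  clift k c G (ren k c i) = G i.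
Proof.
rewrite fsfunE mem_imfset /=; last exact: ren_inj.
case: finsuppP => // _; rewrite /ren; case: (leqP c i) => ci.
  by rewrite ltnNge (leq_trans ci) ?leq_addl //= addKn.
by rewrite ci.
Qed.

Lemma clift_gap (k c : nat) (G : ctx) (i : nat) :
  c <= i < k + c -> clift k c G i = mset0.
Proof.
move=> ci; rewrite fsfunE; case: imfsetP => // -[j _ /=].
by rewrite /ren; case: ifP; lia.
Qed.

(** An index lies either in the gap or in the image of [ren], so these two conditions determine
    [clift]. The algebraic laws below are checked through them. *)
Lemma clift_ext (k c : nat) (G H : ctx) :
  (forall i, H (ren k c i) = G i) ->
  (forall i, c <= i < k + c -> H i = mset0) -> clift k c G = H.
Proof.
move=> Hren Hgap; apply/ctxP => i.
have [ci|] := boolP (c <= i < k + c); first by rewrite clift_gap ?Hgap.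
move=> nci; have -> : i = ren k c (if i < c then i else i - k).
  by move: nci; rewrite /ren; do 2!case: ifP; lia.
by rewrite clift_ren Hren.
Qed.

Lemma cliftD (k c : nat) : {morph clift k c : G H / ctxD G H}.
Proof.
move=> G H; apply: clift_ext => i; first by rewrite !ctxDE !clift_ren.
by move=> ci; rewrite ctxDE !clift_gap // mset0D.
Qed.

Lemma clift_ctx0 (k c : nat) : clift k c ctx0 = ctx0.
Proof. by apply: clift_ext => i; rewrite !ctx0E. Qed.

Lemma clift_ctx1 (k c x : nat) (M : multi) :
  clift k c (ctx1 x M) = ctx1 (ren k c x) M.
Proof.
apply: clift_ext => i; rewrite !ctx1E; first by rewrite (inj_eq (@ren_inj _ _)).
by case: eqP => // ->; rewrite /ren; case: ifP; lia.
Qed.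

Lemma clift_cons (k c : nat) (M : multi) (G : ctx) :
  clift k c.+1 (ctx_cons M G) = ctx_cons M (clift k c G).
Proof.
apply: clift_ext => -[|i] //=; last first.
- by move=> ci; rewrite ctx_consS clift_gap //; lia.
- have -> : ren k c.+1 i.+1 = (ren k c i).+1.
    by rewrite /ren ltnS; case: ifP; lia.
  by rewrite !ctx_consS clift_ren.
- by rewrite !ctx_cons0.
Qed.

Lemma cliftS (k : nat) (G : ctx) :
  clift k.+1 0 G = ctx_cons mset0 (clift k 0 G).
Proof.
apply: clift_ext => [i|[|i] ci]; rewrite ?ctx_cons0 //.
  by rewrite /ren addSn ctx_consS; exact: clift_ren.
by rewrite ctx_consS clift_gap //; lia.
Qed.

(** An untyped variable at the root amounts to one more binder crossed. This is how contexts are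
    counted when [ESub] adds its binder. *)
Lemma clift_cons0 (k : nat) (G : ctx) :
  clift k 0 (ctx_cons mset0 G) = clift k.+1 0 G.
Proof.
apply/esym/clift_ext => i; last first.
  case: (ltnP i k) => ik ci; first by rewrite clift_gap //; lia.
  have -> : i = ren k 0 0 by rewrite /ren /=; lia.
  by rewrite clift_ren ctx_cons0.
have -> : ren k.+1 0 i = ren k 0 i.+1 by rewrite /ren addSnnS.
by rewrite clift_ren ctx_consS.
Qed.

Lemma clift0 (c : nat) (G : ctx) : clift 0 c G = G.
Proof. by apply: clift_ext => i; [rewrite /ren; case: ifP | lia]. Qed.

(** * Lifting *)

Lemma tlift0 (c : nat) (t : term) : tlift 0 c t = t.
Proof.
by elim: t c => [j|u IH|u IHu s IHs|u IHu s IHs] c /=;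
  rewrite ?IH ?IHu ?IHs //; case: ifP.
Qed.

Lemma tlift_tlift (k j c : nat) (t : term) :
  tlift k c (tlift j c t) = tlift (k + j) c t.
Proof.
elim: t c => [i|u IH|u IHu s IHs|u IHu s IHs] c /=; rewrite ?IH ?IHu ?IHs //.
by congr Var; do 2!case: ifP; lia.
Qed.

Lemma elift0 (c : nat) (E : ectx) : elift 0 c E = E.
Proof.
by elim: E c => [|E IH s|E IH s|E IH E' IH'] c //=;
  rewrite ?tlift0 ?IH ?IH'.
Qed.

Lemma elift_elift (k j c : nat) (E : ectx) :
  elift k c (elift j c E) = elift (k + j) c E.
Proof.
by elim: E c => [|E IH s|E IH s|E IH E' IH'] c //=;
  rewrite ?tlift_tlift ?IH ?IH'.
Qed.

Lemma tlift_plug_nc_var (k x : nat) (E : ectx) :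
  tlift k x.+1 (plug_nc E (Var x)) = plug_nc (elift k x.+1 E) (Var x).
Proof.
by rewrite /plug_nc tlift_plug ebinders_elift /= leq_add2l ltnn.
Qed.

(** * Typing rules *)

(* An argument typed with the empty multiset is not typed at all: this merges
   each garbage-collecting rule with its companion. *)
Definition argd (m e : nat) (G : ctx) (t : term) (N : multi) : Prop :=
  if N == mset0 then [/\ m = 0, e = 0 & G = ctx0] else deriv m e G t (TMulti N).

Lemma argdN0 (m e : nat) (G : ctx) (t : term) (N : multi) :
  N <> mset0 -> argd m e G t N = deriv m e G t (TMulti N).
Proof. by rewrite /argd => /eqP/negbTE->. Qed.

Lemma deriv_app (m e m' e' : nat) (G P : ctx) (t s : term) (N M : multi) :
  deriv m e G t (TMulti [mset larr N M]) -> argd m' e' P s N ->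
  deriv (m + m').+1 (e + e') (ctxD G P) (App t s) (TMulti M).
Proof.
rewrite /argd; case: eqP => [-> dt [-> -> ->]|N0 dt ds].
  by rewrite !addn0 ctxD0; exact: DAppGc.
by rewrite -addn1; exact: DApp N0 dt ds.
Qed.

Lemma deriv_appP (m e : nat) (G : ctx) (t s : term) (M : multi) :
  deriv m e G (App t s) (TMulti M) ->
  exists N m1 e1 G1 m2 e2 G2,
    [/\ deriv m1 e1 G1 t (TMulti [mset larr N M]), argd m2 e2 G2 s N,
        m = (m1 + m2).+1, e = e1 + e2 & G = ctxD G1 G2].
Proof.
move=> d; inversion d as [| | | |m1 e1 G1 t0 s0 M0 dt|
  m1 e1 m2 e2 G1 G2 t0 s0 N M0 N0 dt ds| |]; subst.
  exists mset0, m1, e, G, 0, 0, ctx0.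
  by rewrite /argd eqxx !addn0 ctxD0.
by exists N, m1, e1, G1, m2, e2, G2; rewrite argdN0 // addn1.
Qed.

Lemma deriv_subst (m e m' e' : nat) (G P : ctx) (t s : term) (N M : multi) :
  deriv m e (ctx_cons N G) t (TMulti M) -> argd m' e' P s N ->
  deriv (m + m') (e + e') (ctxD G P) (Subst t s) (TMulti M).
Proof.
rewrite /argd; case: eqP => [-> dt [-> -> ->]|N0 dt ds].
  by rewrite !addn0 ctxD0; exact: DSubGc.
exact: DSub N0 dt ds.
Qed.

Lemma deriv_substP (m e : nat) (G : ctx) (t s : term) (M : multi) :
  deriv m e G (Subst t s) (TMulti M) ->
  exists N m1 e1 G1 m2 e2 G2,
    [/\ deriv m1 e1 (ctx_cons N G1) t (TMulti M), argd m2 e2 G2 s N,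
        m = m1 + m2, e = e1 + e2 & G = ctxD G1 G2].
Proof.
move=> d; inversion d as [| | | | | |m1 e1 G1 t0 s0 M0 dt|
  m1 e1 m2 e2 G1 G2 t0 s0 N M0 N0 dt ds]; subst.
  exists mset0, m, e, G, 0, 0, ctx0.
  by rewrite /argd eqxx !addn0 ctxD0.
by exists N, m1, e1, G1, m2, e2, G2; rewrite argdN0.
Qed.

Lemma deriv_varP (m e x : nat) (G : ctx) (M : multi) :
  deriv m e G (Var x) (TMulti M) ->
  [/\ m = 0, e = 1, G = ctx1 x M & M <> mset0].
Proof. by move=> d; inversion d. Qed.

(* A [many] rule, or no derivation at all, as the list of its premises. *)
Lemma argd_lamP (m e : nat) (G : ctx) (u : term) (M : multi) :
  argd m e G (Lam u) M <->
  exists s : seq (nat * nat * ctx * lty),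
    [/\ forall p, p \in s -> deriv p.1.1.1 p.1.1.2 p.1.2 (Lam u) (TLin p.2),
        m = \sum_(p <- s) p.1.1.1, e = \sum_(p <- s) p.1.1.2,
        G = \big[ctxD/ctx0]_(p <- s) p.1.2 & M = seq_mset [seq p.2 | p <- s]].
Proof.
have seq_mset0 (s : seq lty) : seq_mset s = mset0 -> s = [::].
  by case: s => // L s /msetP/(_ L); rewrite mset_seqE mset0E /= eqxx.
rewrite /argd; case: eqP => [->|M0]; split.
- move=> [-> -> ->]; exists [::]; rewrite !big_nil; split=> //.
  by apply/msetP => L; rewrite mset_seqE mset0E.
- by case=> -[|p s] [_ -> -> -> /esym/seq_mset0] //; rewrite !big_nil.
- move=> d; inversion d as [| | |n m1 e1 G1 t L n_gt0 dL| | | |]; subst.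
  exists [seq (m1 i, e1 i, G1 i, L i) | i <- index_enum 'I_n].
  rewrite !big_map -map_comp; split=> //; first last.
    by rewrite [index_enum 'I_n]unlock -enumT.
  by move=> _ /mapP[i _ ->] /=.
- case=> s [ds -> -> -> defM]; rewrite defM.
  have s_gt0 : 0 < size s.
    case: s {ds} defM => // defM; case: M0; rewrite defM.
    by apply/msetP => L; rewrite mset_seqE mset0E.
  (* [DMany] expects a family over ordinals, so the list is read as the tuple of its entries. *)
  have -> : [seq p.2 | p <- s] =
      [seq (tnth (in_tuple s) i).2 | i <- enum 'I_(size s)].
    by rewrite -[s in LHS](map_tnth_enum (in_tuple s)) -map_comp.
  rewrite !(big_tnth _ _ s).
  by apply: DMany => // i; apply: ds; exact: mem_tnth.
Qed.

(** The premises of the [many] rule are reordered so that those with types in [M] come first, and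
    the list is then cut. Going through [argd] covers an empty [M] or [N]. *)
Lemma argd_lamD (m e : nat) (G : ctx) (u : term) (M N : multi) :
  argd m e G (Lam u) (M `+` N) ->
  exists m1 e1 G1 m2 e2 G2,
    [/\ argd m1 e1 G1 (Lam u) M, argd m2 e2 G2 (Lam u) N,
        m = m1 + m2, e = e1 + e2 & G = ctxD G1 G2].
Proof.
case/argd_lamP=> s [ds -> -> -> defMN].
have perm_s : perm_eq [seq p.2 | p <- s] (enum_mset M ++ enum_mset N).
  apply/eq_seq_msetP; rewrite -defMN; apply/msetP => L.
  by rewrite mset_seqE count_cat !count_mem_mset msetE2.
(* [perm_iotaP] gives the permutation of the types as a list of positions, which then reorders the
   whole premises. *)
have [s' perm_s' defs'] : exists2 s', perm_eq s s' &
    [seq p.2 | p <- s'] = enum_mset M ++ enum_mset N.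
  move: perm_s; rewrite perm_sym.
  case/(perm_iotaP lnormal)=> Is perm_Is ->; rewrite size_map in perm_Is.
  exists [seq nth (0, 0, ctx0, lnormal) s i | i <- Is].
    by rewrite perm_sym; apply/(perm_iotaP (0, 0, ctx0, lnormal)); exists Is.
  rewrite -map_comp; apply/eq_in_map => i; rewrite (perm_mem perm_Is).
  by rewrite mem_iota /= => i_s; rewrite (nth_map (0, 0, ctx0, lnormal)).
rewrite !(perm_big _ perm_s') /=.
have {}ds p : p \in s' -> deriv p.1.1.1 p.1.1.2 p.1.2 (Lam u) (TLin p.2).
  by rewrite -(perm_mem perm_s'); exact: ds.
pose n := size (enum_mset M).
have {1 2 3}<- := cat_take_drop n s'; rewrite !big_cat /=.
do 6!eexists; split; [| |reflexivity..]; apply/argd_lamP.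
  exists (take n s'); split=> // [p /mem_take/ds //|].
  by rewrite map_take defs' take_size_cat // seq_mset_id.
exists (drop n s'); split=> // [p /mem_drop/ds //|].
by rewrite map_drop defs' drop_size_cat // seq_mset_id.
Qed.

Lemma deriv_lift (m e : nat) (G : ctx) (t : term) (T : ty) (k c : nat) :
  deriv m e G t T -> deriv m e (clift k c G) (tlift k c t) T.
Proof.
move=> d; elim: d c => {m e G t T}
  [x M M0|t|m e G t M N _ IH|n m e G t L n_gt0 _ IH|m e G t s M _ IH|
   m e m' e' G P t s N M N0 _ IH _ IH'|m e G t s M _ IH|
   m e m' e' G P t s N M N0 _ IH _ IH'] c /=.
- by rewrite clift_ctx1; exact: DAx.
- by rewrite clift_ctx0; exact: DNormal.
- by apply: DFun; rewrite -clift_cons; exact: IH.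
- rewrite (big_morph _ (cliftD k c) (clift_ctx0 k c)).
  by apply: DMany => // i; exact: IH.
- exact: DAppGc (IH c).
- by rewrite cliftD; exact: DApp N0 (IH c) (IH' c).
- by apply: DSubGc; rewrite -clift_cons; exact: IH.
- rewrite cliftD; apply: DSub N0 _ (IH' c).
  by rewrite -clift_cons; exact: IH.
Qed.

Lemma argd_lift (m e : nat) (G : ctx) (t : term) (N : multi) (k c : nat) :
  argd m e G t N -> argd m e (clift k c G) (tlift k c t) N.
Proof.
rewrite /argd; case: eqP => [_ [-> -> ->]|_]; last exact: deriv_lift.
by rewrite clift_ctx0.
Qed.

(** * Evaluation contexts *)

(** The path to the hole is always typed, so the axiom there contributes a nonempty type to the
    variable. In the [ENeed] case, the claim for [E1] at index 0 shows that the argument is typed,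
    which makes the claim for [E2] applicable. *)
Lemma deriv_head_var (m e x : nat) (G : ctx) (E : ectx) (M : multi) :
  deriv m e G (plug E (Var (ebinders E + x))) (TMulti M) -> G x <> mset0.
Proof.
have D_neq0 (A B : multi) : A <> mset0 \/ B <> mset0 -> A `+` B <> mset0.
  move=> AB0 /msetP AB; case: AB0; apply; apply/msetP => L;
  by have := AB L; rewrite msetE2 mset0E; lia.
elim: E m e x G M => [|E IH s|E IH s|E1 IH1 E2 IH2] m e x G M /=.
- by case/deriv_varP=> _ _ ->; rewrite ctx1E eqxx.
- case/deriv_appP=> N [m1 [e1 [G1 [m2 [e2 [G2 [/IH G1x _ _ _ ->]]]]]]].
  by rewrite ctxDE; apply: D_neq0; left.
- case/deriv_substP=> N [m1 [e1 [G1 [m2 [e2 [G2 [d _ _ _ ->]]]]]]].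
  rewrite ctxDE; apply: D_neq0; left.
  by rewrite addSnnS in d; have := IH _ _ _ _ _ d; rewrite ctx_consS.
- case/deriv_substP=> N [m1 [e1 [G1 [m2 [e2 [G2 [d1 d2 _ _ ->]]]]]]].
  rewrite -[ebinders E1]addn0 in d1; have := IH1 _ _ _ _ _ d1.
  rewrite ctx_cons0 => N0; rewrite argdN0 // in d2.
  by rewrite ctxDE; apply: D_neq0; right; exact: IH2 d2.
Qed.

(* The hole of [E] is typed exactly once, by a multi type.  The two equations
   let the type context of the hole change by variables not bound by [E]: [P]
   is taken out and [Q] is put in, stated without subtraction. *)
Lemma deriv_plug (m e : nat) (G : ctx) (E : ectx) (t : term) (M : multi) :
  deriv m e G (plug E t) (TMulti M) ->
  exists m1 e1 G1 N m2 e2,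
    [/\ deriv m1 e1 G1 t (TMulti N), m = m1 + m2, e = e1 + e2,
      forall i, (G1 (ebinders E + i) `<=` G i)%mset &
      forall m' e' G' t' P Q,
        deriv m' e' G' t' (TMulti N) ->
        ctxD G' (clift (ebinders E) 0 P) = ctxD G1 (clift (ebinders E) 0 Q) ->
        exists2 H, deriv (m' + m2) (e' + e2) H (plug E t') (TMulti M) &
                   ctxD H P = ctxD G Q].
Proof.
elim: E m e G M => [|E IH s|E IH s|E1 _ E2 IH] m e G M /=.
- move=> d; exists m, e, G, M, 0, 0; rewrite !addn0; split=> // [i|].
    exact: msubset_refl.
  by move=> m' e' G' t' P Q d'; rewrite !clift0 !addn0 => eqG; exists G'.
- case/deriv_appP=> N [a1 [b1 [H1 [a2 [b2 [H2 [d ds -> -> ->]]]]]]].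
  have [m1 [e1 [G1 [N1 [m2 [e2 [d1 -> -> leG plugE]]]]]]] := IH _ _ _ _ d.
  exists m1, e1, G1, N1, (m2 + a2).+1, (e2 + b2).
  rewrite addnS !addnA; split=> // [i|m' e' G' t' P Q d' eqG].
    apply/msubsetP => L; move/msubsetP: (leG i) => /(_ L).
    by rewrite ctxDE msetE2 => /leq_trans; apply; exact: leq_addr.
  have [H dH eqH] := plugE _ _ _ _ _ _ d' eqG.
  exists (ctxD H H2); first by rewrite addnS !addnA; exact: deriv_app dH ds.
  by rewrite -ctxDA (ctxDC H2) ctxDA eqH -ctxDA (ctxDC Q) ctxDA.
- case/deriv_substP=> N [a1 [b1 [H1 [a2 [b2 [H2 [d ds -> -> ->]]]]]]].
  have [m1 [e1 [G1 [N1 [m2 [e2 [d1 -> -> leG plugE]]]]]]] := IH _ _ _ _ d.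
  exists m1, e1, G1, N1, (m2 + a2), (e2 + b2).
  rewrite !addnA; split=> // [i|m' e' G' t' P Q d' eqG].
    apply/msubsetP => L; move/msubsetP: (leG i.+1) => /(_ L).
    rewrite ctxDE msetE2 addSnnS ctx_consS => /leq_trans; apply.
    exact: leq_addr.
  (* The exchange does not touch the variable bound by this substitution, so [P] and [Q] are
     extended by [mset0] and its type [N] is preserved. *)
  have [|H dH] := plugE _ _ _ _ (ctx_cons mset0 P) (ctx_cons mset0 Q) d'.
    by rewrite !clift_cons0.
  have [H' defH] := ctx_consP H; rewrite defH !ctx_consD !msetD0 in dH *.
  case/ctx_cons_inj=> eqN eqH; rewrite eqN in dH.
  exists (ctxD H' H2); first by rewrite !addnA; exact: deriv_subst dH ds.
  by rewrite -ctxDA (ctxDC H2) ctxDA eqH -ctxDA (ctxDC Q) ctxDA.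
- case/deriv_substP=> N [a1 [b1 [H1 [a2 [b2 [H2 [d ds -> -> ->]]]]]]].
  (* The bound variable heads [E1], so its type is nonempty and the argument, which contains the
     hole, has a derivation. *)
  have N0 : N <> mset0.
    rewrite -[X in Var X]addn0 in d; have := deriv_head_var d.
    by rewrite ctx_cons0.
  rewrite argdN0 // in ds.
  have [m1 [e1 [G1 [N1 [m2 [e2 [d1 -> -> leG plugE]]]]]]] := IH _ _ _ _ ds.
  exists m1, e1, G1, N1, (a1 + m2), (b1 + e2).
  rewrite ![_ + (m1 + _)]addnCA ![_ + (e1 + _)]addnCA.
  split=> // [i|m' e' G' t' P Q d' eqG].
    apply/msubsetP => L; move/msubsetP: (leG i) => /(_ L).
    by rewrite ctxDE msetE2 => /leq_trans; apply; exact: leq_addl.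
  have [H dH eqH] := plugE _ _ _ _ _ _ d' eqG.
  exists (ctxD H1 H); last by rewrite -!ctxDA eqH.
  rewrite addnCA [e' + _]addnCA; apply: deriv_subst d _; by rewrite argdN0.
Qed.

(** * Quantitative subject reduction *)

Lemma deriv_lam1 (m e : nat) (G : ctx) (u : term) (L : lty) :
  deriv m e G (Lam u) (TMulti [mset L]) -> deriv m e G (Lam u) (TLin L).
Proof.
rewrite -argdN0; last by move=> /msetP/(_ L); rewrite msetnxx mset0E.
case/argd_lamP=> s [ds -> -> -> defL].
have: perm_eq [seq p.2 | p <- s] [:: L].
  rewrite perm_sym; apply/eq_seq_msetP; rewrite -defL; apply/msetP => L'.
  by rewrite mset_seqE msetnE /= addn0 eq_sym; case: eqP.
move/perm_small_eq=> /(_ isT); case: s ds {defL} => [|p []] // ds [<-].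
by rewrite !big_seq1; apply: ds; rewrite inE.
Qed.

Lemma deriv_lam_arr (m e : nat) (G : ctx) (u : term) (N M : multi) :
  deriv m e G (Lam u) (TMulti [mset larr N M]) ->
  deriv m e (ctx_cons N G) u (TMulti M).
Proof.
move/deriv_lam1; move eqt: (Lam u) => t; move eqT: (TLin _) => T d.
case: d eqt eqT => // m1 e1 G1 t1 N1 M1 d1 [->] eqT.
(* [larr] is not a constructor: the equation between types is projected to linear types and solved
   by [larr_inj]. *)
pose lin T := if T is TLin L then L else lnormal.
by have /larr_inj[-> ->] : larr N M = larr N1 M1 := congr1 lin eqT.
Qed.

(** Induction on [S], carrying the argument inwards. Each substitution crossed lifts it by one, and
    the lifted context gives [mset0] to the new variable, so the type [K] required of [r] does not
    change. *)
Lemma deriv_beta (S : sctx) (m e m' e' : nat) (G P : ctx) (t s : term)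
    (N M : multi) :
  deriv m e G (splug S (Lam t)) (TMulti [mset larr N M]) ->
  argd m' e' P s N ->
  deriv (m + m') (e + e') (ctxD G P)
    (splug S (Subst t (tlift (sbinders S) 0 s))) (TMulti M).
Proof.
elim: S m e m' e' G P s => [|S IH r] m e m' e' G P s /=.
  by move=> /deriv_lam_arr dt ds; rewrite tlift0; exact: deriv_subst dt ds.
case/deriv_substP=> K [m1 [e1 [G1 [m2 [e2 [G2 [d dr -> -> ->]]]]]]] ds.
have := IH _ _ _ _ _ _ _ d (argd_lift 1 0 ds).
rewrite tlift_tlift addn1 cliftS clift0 ctx_consD msetD0 => d'.
rewrite addnAC [e1 + _ + _]addnAC -ctxDA (ctxDC G2) ctxDA.
exact: deriv_subst d' dr.
Qed.

(** The axiom at the hole uses a part [N1] of [N]. The derivation of the value splits accordingly: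
    the [N1] part replaces the axiom, and the rest types the value left in the substitution. The
    axiom's exponential count of 1 is what disappears. *)
Lemma deriv_fetch (E : ectx) (m e m' e' : nat) (G P : ctx) (u : term)
    (N M : multi) :
  deriv m e (ctx_cons N G) (plug_nc E (Var 0)) (TMulti M) ->
  deriv m' e' P (Lam u) (TMulti N) ->
  exists2 f, e + e' = f.+1 &
    deriv (m + m') f (ctxD G P)
      (Subst (plug_nc E (tlift 1 0 (Lam u))) (Lam u)) (TMulti M).
Proof.
move=> dE; have N0 : N <> mset0.
  by have := deriv_head_var dE; rewrite ctx_cons0.
case/deriv_plug: dE => m1 [e1 [G1 [N1 [m2 [e2]]]]].
rewrite /= addn0 => -[/deriv_varP[-> -> -> N1_0] -> -> /(_ 0) leN plugE].
rewrite addn0 ctx_cons0 ctx1E eqxx in leN.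
have defN : N = (N1 `+` (N `\` N1))%mset.
  by apply/msetP => L; move/msubsetP: leN => /(_ L); rewrite !msetE2; lia.
rewrite -argdN0 // [in argd _ _ _ _ N]defN => /argd_lamD.
case=> a1 [b1 [P1 [a2 [b2 [P2 [d1 d2 -> -> ->]]]]]].
rewrite argdN0 // in d1.
(* Taken out: the axiom's [N1] at index 0. Put in: the context of the copied value, lifted once for
   the substitution and then for the binders of [E]. *)
have [|H dH] := plugE _ _ _ _ (ctx1 0 N1) (clift 1 0 P1)
  (deriv_lift (ebinders E) 0 (deriv_lift 1 0 d1)).
  by rewrite clift_ctx1 /ren /= addn0 ctxDC.
have -> : ctx1 0 N1 = ctx_cons N1 ctx0.
  by apply/ctxP => -[|i]; rewrite ctx1E ?ctx_cons0 ?ctx_consS ?ctx0E.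
rewrite cliftS clift0 ctx_consD msetD0 defN msetDC.
(* Cancelling [N1] at index 0 on both sides leaves the variable with exactly the remaining type
   [N]\[N1]. *)
rewrite -{1}[ctxD G P1]ctxD0 -ctx_consD => /ctxDI defH.
exists (b1 + e2 + b2); first by lia.
rewrite (_ : 0 + m2 + (a1 + a2) = a1 + m2 + a2); last by lia.
by rewrite ctxDA; apply: deriv_subst d2; rewrite -defH.
Qed.

Lemma deriv_root_m (m e : nat) (G : ctx) (t s : term) (M : multi) :
  root_m t s -> deriv m e G t (TMulti M) ->
  exists2 n, m = n.+1 & deriv n e G s (TMulti M).
Proof.
case=> S u r /deriv_appP[N [m1 [e1 [G1 [m2 [e2 [G2 [d dr -> -> ->]]]]]]]].
by exists (m1 + m2) => //; exact: deriv_beta d dr.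
Qed.

Lemma deriv_root_e (m e : nat) (G : ctx) (t s : term) (M : multi) :
  root_e t s -> deriv m e G t (TMulti M) ->
  exists2 f, e = f.+1 & deriv m f G s (TMulti M).
Proof.
case=> E S u /deriv_substP[N [m1 [e1 [G1 [m2 [e2 [G2 [dE d -> -> ->]]]]]]]].
move: d; rewrite argdN0; last first.
  by have := deriv_head_var dE; rewrite ctx_cons0.
(* [E] is generalized because each substitution of [S] that moves outwards lifts it, at cutoff 1 so
   that the variable of index 0 stays fixed. *)
elim: S E m1 e1 G1 m2 e2 G2 dE => [|S IH r] E m1 e1 G1 m2 e2 G2 dE /=.
  by rewrite elift0; exact: deriv_fetch.
case/deriv_substP=> K [a1 [b1 [H1 [a2 [b2 [H2 [d dr -> -> ->]]]]]]].
have := deriv_lift 1 1 dE.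
rewrite clift_cons cliftS clift0 tlift_plug_nc_var => dE1.
have [f def_f] := IH _ _ _ _ _ _ _ dE1 d.
rewrite elift_elift addn1 ctx_consD mset0D => d'.
exists (f + b2); first by rewrite addnA def_f.
by rewrite addnA ctxDA; exact: deriv_subst d' dr.
Qed.

Lemma deriv_step_m (m e : nat) (G : ctx) (t s : term) (M : multi) :
  step_m t s -> deriv m e G t (TMulti M) ->
  exists2 n, m = n.+1 & deriv n e G s (TMulti M).
Proof.
case=> E {}t {}s ts /deriv_plug[m1 [e1 [G1 [N [m2 [e2 [d -> -> _ plugE]]]]]]].
have [n -> dn] := deriv_root_m ts d.
(* The root step preserves the context of the hole, so nothing is exchanged. *)
have [//|H dH] := plugE _ _ _ _ ctx0 ctx0 dn.
by rewrite !ctxD0 => defH; exists (n + m2); rewrite // -defH.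
Qed.

Lemma deriv_step_e (m e : nat) (G : ctx) (t s : term) (M : multi) :
  step_e t s -> deriv m e G t (TMulti M) ->
  exists2 f, e = f.+1 & deriv m f G s (TMulti M).
Proof.
case=> E {}t {}s ts /deriv_plug[m1 [e1 [G1 [N [m2 [e2 [d -> -> _ plugE]]]]]]].
have [f -> df] := deriv_root_e ts d.
have [//|H dH] := plugE _ _ _ _ ctx0 ctx0 df.
by rewrite !ctxD0 => defH; exists (f + e2); rewrite // -defH.
Qed.

(** The abstraction is typed by the rule for [normal], in the empty context. Hence each surrounding
    substitution binds an untyped variable, and its argument has no derivation and adds nothing. *)
Lemma deriv_normal (m e : nat) (G : ctx) (t : term) :
  normal t -> deriv m e G t (TMulti [mset lnormal]) ->
  [/\ m = 0, e = 0 & G = ctx0].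
Proof.
move=> nt; elim: nt m e G => {t} [u|t s _ IH] m e G.
  by move/deriv_lam1 => d; inversion d.
case/deriv_substP=> N [m1 [e1 [G1 [m2 [e2 [G2 [/IH[-> -> G0] ds -> -> ->]]]]]]].
rewrite -ctx_cons00 in G0; have [defN ->] := ctx_cons_inj G0.
by move: ds; rewrite /argd defN eqxx => -[-> -> ->]; rewrite ctxD0.
Qed.

(** * Progress *)

Lemma normal_splug (t : term) :
  normal t -> exists S u, t = splug S (Lam u).
Proof.
elim=> {t} [u|t s _ [S [u ->]]]; first by exists SHole, u.
by exists (SSub S s), u.
Qed.

Lemma progress (t : term) :
  [\/ normal t, exists s, step_m t s, exists s, step_e t s
    | exists E x, t = plug E (Var (ebinders E + x))].
Proof.
elim: t => [x|u _|t IH s _|t IHt s IHs].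
- by constructor 4; exists EHole, x.
- by constructor 1; constructor.
- case: IH => [/normal_splug[S [u ->]]|[_ [E t1 t2 st]]|[_ [E t1 t2 st]]|
    [E [x ->]]].
  + constructor 2; exists (splug S (Subst u (tlift (sbinders S) 0 s))).
    by apply: (StepM EHole); constructor.
  + by constructor 2; exists (plug (EApp E s) t2); exact: (StepM (EApp E s)).
  + by constructor 3; exists (plug (EApp E s) t2); exact: (StepE (EApp E s)).
  + by constructor 4; exists (EApp E s), x.
(* A head variable of index 0 is the one bound here and makes the argument needed. Any other index
   remains a free head variable, shifted down by one. *)
- case: IHt => [nt|[_ [E t1 t2 st]]|[_ [E t1 t2 st]]|[E [[|x] ->]]].
  + by constructor 1; constructor.
  + by constructor 2; exists (plug (ESub E s) t2); exact: (StepM (ESub E s)).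
  + by constructor 3; exists (plug (ESub E s) t2); exact: (StepE (ESub E s)).
  + case: IHs => [/normal_splug[S [u ->]]|[_ [E' t1 t2 st]]|[_ [E' t1 t2 st]]|
      [E' [x ->]]].
    * constructor 3; eexists; apply: (StepE EHole); exact: RootE.
    * constructor 2; exists (plug (ENeed E E') t2).
      by rewrite addn0; exact: (StepM (ENeed E E')).
    * constructor 3; exists (plug (ENeed E E') t2).
      by rewrite addn0; exact: (StepE (ENeed E E')).
    * by constructor 4; exists (ENeed E E'), x; rewrite addn0.
  + by constructor 4; exists (ESub E s), x; rewrite /= addSnnS.
Qed.

(** * Evaluation measured by the counters *)

Theorem theorem5 (t : term) (M : multi) (m e : nat)
    (t_closed : closed_term t)
    (Phi : deriv m e ctx0 t (TMulti M)) :
  exists (s : term) (d : evseq t s),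
    [/\ normal s,
        size_m d <= m,
        size_e d <= e
      & tight Phi -> size_m d = m /\ size_e d = e].
Proof.
(* Once unfolded, tightness no longer mentions the derivation, so term and counters can vary in the
   induction. *)
rewrite /tight; move: Phi => {t_closed}.
have [k] := ubnP (m + e); elim: k => // k IH in t m e *; rewrite ltnS => le_k d.
case: (progress t) => [nt|[s ts]|[s ts]|[E [x def_t]]].
- exists t, (EvNil t); split=> // -[[defM] _]; subst M.
  by have [-> -> _] := deriv_normal nt d.
- have [n def_m dn] := deriv_step_m ts d; subst m.
  have [r [d' [nr le_m le_e tight_r]]] := IH _ _ _ le_k dn.
  by exists r, (EvM ts d'); split=> //= /tight_r[-> ->].
- have [f def_e df] := deriv_step_e ts d; subst e; rewrite addnS in le_k.
  have [r [d' [nr le_m le_e tight_r]]] := IH _ _ _ le_k df.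
  by exists r, (EvE ts d'); split=> //= /tight_r[-> ->].
- by rewrite def_t in d; have := deriv_head_var d; rewrite ctx0E.
Qed.
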